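(* For each integer $n\ge 2$, the $n\times n\times n$ cube $[n]^3$ can be dismantled to the disjoint union of $NHO(n)$ and a rotated copy of $NHO(n-1)$, namely the copy $\rho_n(NHO(n-1))$ whose triangular base is $\rho_n(UTB(n-1))=LTB(n-1)$.
   Context: $[n]^3$ denotes the graph whose vertices (also called cubes) are the triples $(i,j,k)$ with $i,j,k\in\{1,\dots,n\}$; two vertices are neighbours if they differ in exactly one coordinate, and in that coordinate by exactly $1$. A position is any subset of the vertices. $[n]^3$ can be dismantled to a position $Q$ if $Q$ is obtained from the full position $[n]^3$ by a finite sequence of moves, each removing a vertex that has exactly $3$ neighbours in the current position. In $[n]^3$, for $1\le m\le n$ the upper triangular base of order $m$ is $UTB(m)=\{(i,j,k)\in[n]^3: i+j-k=m+1-n\}$, and for $1\le m\le n-1$ the lower triangular base of order $m$ is $LTB(m)=\{(i,j,k)\in[n]^3: i+j-k=2n-m\}$. The heap of oranges is $HO(n)=\bigcup_{m=1}^{n}UTB(m)=\{(i,j,k)\in[n]^3:i+j-k\le 1\}$. The nested heap of oranges $NHO(n)$ is obtained from $HO(n)$ by adding all vertices of $[n]^3$ outside it having exactly $3$ neighbours in it, and repeating this with the resulting set, so that successively translated copies of triangular bases of orders $n-2,n-4,\dots$ (ending with order $2$ if $n$ is even and order $1$ if $n$ is odd) are added; explicitly, $$NHO(n)=HO(n)\cup\bigcup_{l\ge 1,\ 2l<n}\{(i,j,k)\in[n]^3: i+j-k=1+l,\ i\ge l+1,\ j\ge l+1,\ k\le n-l\}.$$ $NHO(n-1)$ is the same construction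 carried out in $[n-1]^3$ (with $n-1$ in place of $n$ everywhere). The rotated copy of it in $[n]^3$ is its image under $\rho_n:[n-1]^3\to[n]^3$, $\rho_n(i,j,k)=(n+1-j,\,n+1-i,\,n-k)$, which maps $UTB(n-1)\subset[n-1]^3$ onto $LTB(n-1)\subset[n]^3$. *)

(* Defs.v *)
From mathcomp Require Import all_boot all_order all_algebra.

Set Implicit Arguments.
Unset Strict Implicit.
Unset Printing Implicit Defensive.

Import GRing.Theory.

(* The vertex (i, j, k) of [n]^3 is encoded by the triple of ordinals
   (i-1, j-1, k-1); ci, cj and ck recover the coordinates in {1, ..., n}. *)
Definition cube (n : nat) : finType := ('I_n * 'I_n * 'I_n)%type.

Definition ci n (x : cube n) : nat := x.1.1.+1.
Definition cj n (x : cube n) : nat := x.1.2.+1.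
Definition ck n (x : cube n) : nat := x.2.+1.

Definition consecutive (a b : nat) : bool := (b == a.+1) || (a == b.+1).

Definition adj n : rel (cube n) := fun x y =>
  [|| [&& consecutive (ci x) (ci y), cj x == cj y & ck x == ck y],
      [&& ci x == ci y, consecutive (cj x) (cj y) & ck x == ck y]
    | [&& ci x == ci y, cj x == cj y & consecutive (ck x) (ck y)]].

Definition move n : rel {set cube n} := fun P Q =>
  [exists x in P, (#|[set y in P | adj x y]| == 3) && (Q == P :\ x)].

(* connect is the reflexive transitive closure, so this says that Q is reached
   from the full position by a finite sequence of moves. *)
Definition can_be_dismantled_to n (Q : {set cube n}) : Prop :=
  connect (@move n) [set: cube n] Q.

(* Computed in int: the value i + j - k can be negative. *)
Definition level n (x : cube n) : int :=
  ((ci x)%:Z + (cj x)%:Z - (ck x)%:Z)%R.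

Definition UTB (n m : nat) : {set cube n} :=
  [set x | level x == (m%:Z + 1 - n%:Z)%R].

Definition LTB (n m : nat) : {set cube n} :=
  [set x | level x == ((2 * n)%:Z - m%:Z)%R].

Definition HO (n : nat) : {set cube n} := \bigcup_(1 <= m < n.+1) UTB n m.

(* The translated copy of the triangular base of order n - 2l. *)
Definition nested_layer (n l : nat) : {set cube n} :=
  [set x | [&& level x == (1 + l%:Z)%R,
               l.+1 <= ci x, l.+1 <= cj x & ck x <= n - l]].

Definition NHO (n : nat) : {set cube n} :=
  HO n :|: \bigcup_(1 <= l < n | 2 * l < n) nested_layer n l.

Lemma rho_subproof n (a : 'I_n.-1) : n.-1 - a < n.
Proof. by case: n a => [[]//|n] a; rewrite ltnS leq_subr. Qed.

Lemma rho_subproof3 n (a : 'I_n.-1) : n.-2 - a < n.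
Proof.
by case: n a => [[]//|[[]//|n]] a; rewrite ltnS (leq_trans (leq_subr _ _)).
Qed.

(* In the 1-based coordinates, (i, j, k) |-> (n+1-j, n+1-i, n-k): see rhoE. *)
Definition rho n (x : cube n.-1) : cube n :=
  (Ordinal (rho_subproof x.1.2), Ordinal (rho_subproof x.1.1),
   Ordinal (rho_subproof3 x.2)).

Lemma rhoE n (x : cube n.-1) :
  [/\ ci (rho x) = n + 1 - cj x, cj (rho x) = n + 1 - ci x
    & ck (rho x) = n - ck x].
Proof.
case: n x => [[[[]//]]|[[[[]//]]|n]] [[i j] k] /=.
rewrite /ci /cj /ck /= !addn1 !subSS.
have le_ord (a : 'I_n.+1) : a <= n by exact: leq_ord.
by rewrite !subSn ?le_ord // leqW ?le_ord.
Qed.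

(* Main.v *)
Require Import Defs.
From mathcomp Require Import all_boot all_order all_algebra.
From mathcomp Require Import zify.

(* In the coordinates (a, b, c) = (i-1, j-1, n-k), let m be the distance of a
   cube to the low faces (the least coordinate) and M its distance to the high
   faces. The target position is a + b + c < n + m together with
   a + b + c + M >= 2n - 1. All other cubes are peeled off shell by shell: first
   those near the low faces with m = 0, then those near the high faces with
   M = 0, then m = 1, M = 1, and so on. A low shell (m <= M) is peeled by
   decreasing a + b + c and a high shell by increasing a + b + c. When a cube is
   removed, its extremal coordinate is unique, and exactly three of its
   neighbours remain: the one with that coordinate moved towards the centre, and
   the two with another coordinate moved in the opposite sense. *)

Set Implicit Arguments.
Unset Strict Implicit.
Unset Printing Implicit Defensive.

(** * Dismantling along a rank function *)

(** Remove a cube of least rank outside [Q] each time: its neighbours still present are exactly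
    those in [Q] and those of larger rank. Ties between non-adjacent cubes are harmless. *)
Lemma connect_move_rank n (Q : {set cube n}) (r : cube n -> nat) :
    (forall x y, adj x y -> y \notin Q -> r y != r x) ->
    (forall x, x \notin Q ->
       #|[set y | adj x y && ((y \in Q) || (r x < r y))]| = 3) ->
  can_be_dismantled_to Q.
Proof.
move=> r_adj deg3; rewrite /can_be_dismantled_to.
(* Invariant: no removed cube outranks a cube still to be removed. *)
have: forall y z,
    y \notin [set: cube n] -> z \in [set: cube n] :\: Q -> r y <= r z.
  by move=> y z; rewrite inE.
have: Q \subset [set: cube n] by exact: subsetT.
have [k] := ubnP #|[set: cube n] :\: Q|.
elim: k [set: cube n] => // k IHk P le_k sQP closedP.
have [/eqP PQ0 | [x0 PQx0]] := set_0Vmem (P :\: Q).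
  have -> : P = Q by apply/eqP; rewrite eqEsubset sQP andbT -setD_eq0.
  exact: connect0.
case: (arg_minnP r PQx0) => x PQx min_x.
have {}min_x z : z \in P -> z \notin Q -> r x <= r z.
  by move=> Pz Q'z; apply/min_x/setDP.
have /setDP[Px Q'x] := PQx.
have PDx : (P :\ x) :\: Q = (P :\: Q) :\ x by rewrite setDDl setUC -setDDl.
apply: (connect_trans (y := P :\ x)).
  apply/connect1/existsP; exists x; rewrite Px eqxx andbT /=.
  apply/eqP; rewrite -(deg3 x Q'x); congr #|pred_of_set _|.
  apply/setP=> y; rewrite !inE [RHS]andbC [LHS]andbC.
  case: (boolP (adj x y)) => [xy|_]; rewrite ?andbT ?andbF //.
  have [Qy | Q'y] := boolP (y \in Q); first by rewrite (subsetP sQP).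
  have [Py | P'y] := boolP (y \in P).
    by rewrite ltn_neqAle eq_sym r_adj //= min_x.
  by rewrite ltnNge closedP.
apply: IHk => [||y z].
- by rewrite PDx; move: le_k; rewrite (cardsD1 x (P :\: Q)) in_setD Q'x Px.
- by rewrite subsetD1 sQP.
- rewrite PDx !in_setD1 in_setD negb_and negbK => P'y /and3P[_ Q'z Pz].
  case/orP: P'y => [/eqP-> | P'y]; first exact: min_x.
  by apply: closedP; rewrite // in_setD Q'z.
Qed.

Lemma in_bigcup_seq (I : Type) (T : finType) (r : seq I) (P : pred I)
    (F : I -> {set T}) x :
  (x \in \bigcup_(i <- r | P i) F i) = has (fun i => P i && (x \in F i)) r.
Proof.
rewrite (big_morph (fun A : {set T} => x \in A) (id1 := false) (op1 := orb)).
- by rewrite big_has_cond.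
- by move=> A B; rewrite inE.
- by rewrite inE.
Qed.

(** * The target position and the removal order in coordinates *)

Definition min3 a b c := minn a (minn b c).
Definition gap3 n a b c := n.-1 - maxn a (maxn b c).

(** Equivalently, for coordinates below [n]: the two largest sum to less than [n], or the two
    smallest sum to at least [n]. *)
Definition kept n a b c :=
  (a + b + c < n + min3 a b c) || (2 * n <= a + b + c + gap3 n a b c + 1).

(* The low shell m has stage 2m and the high shell M has stage 2M + 1. *)
Definition stage n a b c := minn (2 * min3 a b c) (2 * gap3 n a b c).+1.

(* [(a, b, c)] is removed before [(a', b', c')], assuming neither is kept. *)
Definition before n a b c a' b' c' :=
  (stage n a b c < stage n a' b' c') ||
  (stage n a b c == stage n a' b' c') &&
    (if min3 a b c <= gap3 n a b c then a' + b' + c' < a + b + c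
     else a + b + c < a' + b' + c').

Definition later n a b c a' b' c' := kept n a' b' c' || before n a b c a' b' c'.

Definition adj3 a b c a' b' c' :=
  [|| [&& consecutive a a', b == b' & c == c'],
      [&& a == a', consecutive b b' & c == c']
    | [&& a == a', b == b' & consecutive c c']].

(** * Symmetry in the three coordinates *)

Lemma min3CA a b c : min3 b a c = min3 a b c.
Proof. exact: minnCA. Qed.

Lemma min3AC a b c : min3 a c b = min3 a b c.
Proof. by rewrite /min3 (minnC c). Qed.

Lemma gap3CA n a b c : gap3 n b a c = gap3 n a b c.
Proof. by rewrite /gap3 maxnCA. Qed.

Lemma gap3AC n a b c : gap3 n a c b = gap3 n a b c.
Proof. by rewrite /gap3 (maxnC c). Qed.

Lemma keptCA n a b c : kept n b a c = kept n a b c.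
Proof. by rewrite /kept min3CA gap3CA (addnC b). Qed.

Lemma keptAC n a b c : kept n a c b = kept n a b c.
Proof. by rewrite /kept min3AC gap3AC addnAC. Qed.

Lemma laterCA n a b c a' b' c' :
  later n b a c b' a' c' = later n a b c a' b' c'.
Proof.
rewrite /later /before /stage keptCA !(min3CA a, min3CA a').
by rewrite !(gap3CA _ a, gap3CA _ a') (addnC b) (addnC b').
Qed.

Lemma laterAC n a b c a' b' c' :
  later n a c b a' c' b' = later n a b c a' b' c'.
Proof.
rewrite /later /before /stage keptAC !(min3AC a b, min3AC a' b').
rewrite !(gap3AC _ a b, gap3AC _ a' b').
by rewrite (addnAC a) (addnAC a').
Qed.

Lemma adj3CA a b c a' b' c' : adj3 b a c b' a' c' = adj3 a b c a' b' c'.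
Proof. by rewrite /adj3 /consecutive; lia. Qed.

Lemma adj3AC a b c a' b' c' : adj3 a c b a' c' b' = adj3 a b c a' b' c'.
Proof. by rewrite /adj3 /consecutive; lia. Qed.

(** * Neighbours that outlive a removed cube *)

(** Here [n <= b + c], [a + b < n] and [a + c < n], so [a] is the strict minimum. Raising [a] raises
    the stage; lowering [b] or [c] keeps it and lowers the sum. The opposite steps reach cubes
    removed earlier. *)
Lemma later_low n a b c a' b' c' :
    b < n -> c < n -> a <= b -> a <= c -> a <= gap3 n a b c ->
    ~~ kept n a b c ->
    [/\ a' < n, b' < n & c' < n] -> adj3 a b c a' b' c' ->
  later n a b c a' b' c' = [|| a' == a.+1, b == b'.+1 | c == c'.+1].
Proof.
move=> lt_b lt_c le_ab le_ac le_gap.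
have am : min3 a b c = a by rewrite /min3; lia.
rewrite /later /before /kept negb_or am le_gap /stage am => /andP[lo hi].
have -> : minn (2 * a) (2 * gap3 n a b c).+1 = 2 * a by lia.
move: le_gap lo hi; rewrite /gap3 /min3 /adj3 /consecutive {am}.
have -> : maxn a (maxn b c) = maxn b c by lia.
move=> le_gap lo hi.
have [ltab ltac] : a < b /\ a < c by lia.
have {}lo : n <= b + c by lia.
have {}hi : a + b + c + n <= 2 * n + maxn b c - 1 by lia.
have {}le_gap : b + a < n /\ c + a < n by lia.
clear le_ab le_ac.
move=> [? ? ?].
move=> /or3P[] /and3P[].
- by move=> + /eqP<- /eqP<-; case/orP => /eqP ?; subst; lia.
- by move=> /eqP<- + /eqP<-; case/orP => /eqP ?; subst; lia.
- by move=> /eqP<- /eqP<-; case/orP => /eqP ?; subst; lia.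
Qed.

(** Dually, [n <= a + b], [n <= a + c] and [b + c < n] make [a] the strict maximum; lowering [a]
    raises the stage, raising [b] or [c] keeps it and raises the sum. *)
Lemma later_high n a b c a' b' c' :
    a < n -> b <= a -> c <= a -> gap3 n a b c < min3 a b c -> ~~ kept n a b c ->
    [/\ a' < n, b' < n & c' < n] -> adj3 a b c a' b' c' ->
  later n a b c a' b' c' = [|| a == a'.+1, b' == b.+1 | c' == c.+1].
Proof.
move=> lt_a le_ba le_ca lt_gap.
have aM : gap3 n a b c = n.-1 - a by rewrite /gap3; lia.
rewrite /later /before /kept negb_or /stage (leqNgt (min3 a b c)) lt_gap /=.
move=> /andP[lo hi].
have -> : minn (2 * min3 a b c) (2 * gap3 n a b c).+1 = (2 * (n.-1 - a)).+1.
  by lia.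
move: lt_gap lo hi; rewrite aM /gap3 /min3 /adj3 /consecutive {aM}.
move=> lt_gap lo hi.
have {}lt_gap : n <= a + b /\ n <= a + c by lia.
have {}hi : b + c < n by lia.
have {}lo : n + minn b c <= a + b + c by lia.
have [ltba ltca] : b < a /\ c < a by lia.
clear le_ba le_ca.
move=> [? ? ?].
move=> /or3P[] /and3P[].
- by move=> + /eqP<- /eqP<-; case/orP => /eqP ?; subst; lia.
- by move=> /eqP<- + /eqP<-; case/orP => /eqP ?; subst; lia.
- by move=> /eqP<- /eqP<-; case/orP => /eqP ?; subst; lia.
Qed.

(** * The removal order as a numerical rank *)

Definition offset n a b c :=
  if min3 a b c <= gap3 n a b c then 3 * n - (a + b + c) else a + b + c.

(** Offsets of cubes are at most [3 * n], so the stage dominates. *)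
Definition rank n a b c := stage n a b c * (3 * n).+1 + offset n a b c.

Lemma rank_lt n a b c a' b' c' :
    a + b + c <= 3 * n -> a' + b' + c' <= 3 * n ->
  (rank n a b c < rank n a' b' c') = before n a b c a' b' c'.
Proof.
have offset_le p q r : p + q + r <= 3 * n -> offset n p q r <= 3 * n.
  by rewrite /offset; case: ifP; rewrite ?leq_subr.
move=> le_x le_y; have := (offset_le _ _ _ le_x, offset_le _ _ _ le_y).
rewrite /before /rank; have [lt_xy|lt_yx|eq_xy] /= :=
  ltngtP (stage n a b c) (stage n a' b' c') => -[? ?].
- have: (stage n a b c).+1 * (3 * n).+1 <= stage n a' b' c' * (3 * n).+1.
    by rewrite leq_mul2r lt_xy orbT.
  by lia.
- have: (stage n a' b' c').+1 * (3 * n).+1 <= stage n a b c * (3 * n).+1.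
    by rewrite leq_mul2r lt_yx orbT.
  by lia.
rewrite eq_xy ltn_add2l /offset.
(* Stages are even on low shells and odd on high ones. *)
have -> : (min3 a' b' c' <= gap3 n a' b' c') = (min3 a b c <= gap3 n a b c).
  by move: eq_xy; rewrite /stage; lia.
by case: ifP => _ //; lia.
Qed.

(* Replacing k by n - k makes level, hence both heaps, symmetric in the three
   coordinates. *)
Definition cw n (x : cube n) : nat := n.-1 - x.2.

Lemma coord_lt n (x : cube n) : [/\ x.1.1 < n, x.1.2 < n & cw x < n].
Proof.
by case: x => [[i j] k]; split=> //; rewrite /cw /=; case: k => /=; lia.
Qed.

Lemma sum_le n (x : cube n) : x.1.1 + x.1.2 + cw x <= 3 * n.
Proof. by case: (coord_lt x); lia. Qed.

Lemma adjE n (x y : cube n) :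
  adj x y = adj3 x.1.1 x.1.2 (cw x) y.1.1 y.1.2 (cw y).
Proof.
case: x y => [[i j] k] [[i' j'] k']; have := (ltn_ord k, ltn_ord k').
by rewrite /adj /adj3 /consecutive /ci /cj /ck /cw /= => -[? ?]; lia.
Qed.

Definition crank n (x : cube n) := rank n x.1.1 x.1.2 (cw x).

(** Coordinate sums of neighbours differ by 1, so at equal stages one precedes the other. *)
Lemma adj_crank_neq n (x y : cube n) : adj x y -> crank y != crank x.
Proof.
rewrite adjE => xy; apply/negP => /eqP eq_yx.
have := rank_lt (sum_le x) (sum_le y); have := rank_lt (sum_le y) (sum_le x).
rewrite -/(crank x) -/(crank y) eq_yx ltnn /before /stage.
by move: xy; rewrite /adj3 /consecutive; do 2![case: ifP]; lia.
Qed.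

(** * Exactly three neighbours remain *)

Definition step (up : bool) (a : nat) : nat := if up then a.+1 else a.-1.

Definition inner n (up : bool) (a : 'I_n) : bool :=
  if up then a.+1 < n else 0 < a.

Lemma inner_step n up (a : 'I_n) : inner up a -> step up a < n.
Proof. by have := ltn_ord a; case: up; rewrite /inner /step //; lia. Qed.

(** Neighbours differ in one coordinate, so each equation picks out a single cube, which [inner]
    keeps inside the grid. *)
Lemma card_adj_steps n (x : cube n) (ui uj uk : bool) (P : pred (cube n)) :
    inner ui x.1.1 -> inner uj x.1.2 -> inner uk x.2 ->
    (forall y, adj x y -> P y =
       [|| y.1.1 == step ui x.1.1 :> nat, y.1.2 == step uj x.1.2 :> nat
         | y.2 == step uk x.2 :> nat]) ->
  #|[set y | adj x y && P y]| = 3.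
Proof.
move=> in_i in_j in_k PE.
case: x in_i in_j in_k PE => [[i j] k] /= in_i in_j in_k PE.
pose yi : cube n := (Ordinal (inner_step in_i), j, k).
pose yj : cube n := (i, Ordinal (inner_step in_j), k).
pose yk : cube n := (i, j, Ordinal (inner_step in_k)).
have -> : [set y | adj (i, j, k) y && P y] = yi |: [set yj; yk].
  apply/setP=> y; rewrite !inE.
  transitivity (adj (i, j, k) y &&
    [|| y.1.1 == step ui i :> nat, y.1.2 == step uj j :> nat
      | y.2 == step uk k :> nat]).
    by case: (boolP (adj _ y)) => // /PE->.
  case: y => [[i' j'] k']; rewrite /yi /yj /yk !xpair_eqE -!val_eqE /=.
  rewrite /adj /consecutive /ci /cj /ck /=.
  move: (in_i) (in_j) (in_k); rewrite /inner /step.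
  by case: (ui); case: (uj); case: (uk) => ? ? ?; lia.
rewrite cardsU1 cards2 !inE /yi /yj /yk !xpair_eqE -!val_eqE /=.
move: (in_i) (in_j) (in_k); rewrite /inner /step.
by case: (ui); case: (uj); case: (uk) => ? ? ?; lia.
Qed.

Definition ckept n (x : cube n) := kept n x.1.1 x.1.2 (cw x).

Definition clater n (x y : cube n) :=
  later n x.1.1 x.1.2 (cw x) y.1.1 y.1.2 (cw y).

Lemma card_clater n (x : cube n) :
  ~~ ckept x -> #|[set y | adj x y && clater x y]| = 3.
Proof.
move=> Kx; have [lt_i lt_j lt_w] := coord_lt x.
have wE (y : cube n) : y.2 + cw y = n.-1.
  by rewrite /cw; have := ltn_ord y.2; lia.
have wx := wE x.
have not_kept := Kx; rewrite /ckept /kept in not_kept.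
have [le_mM|lt_Mm] :=
  leqP (min3 x.1.1 x.1.2 (cw x)) (gap3 n x.1.1 x.1.2 (cw x)).
- have minE : min3 x.1.1 x.1.2 (cw x) = x.1.1 \/
      min3 x.1.1 x.1.2 (cw x) = x.1.2 \/ min3 x.1.1 x.1.2 (cw x) = cw x.
    by rewrite /min3; lia.
  have [le_i le_j le_w] : [/\ min3 x.1.1 x.1.2 (cw x) <= x.1.1,
      min3 x.1.1 x.1.2 (cw x) <= x.1.2 & min3 x.1.1 x.1.2 (cw x) <= cw x].
    by rewrite /min3; split; lia.
  case: minE => [minE|[minE|minE]]; rewrite minE in le_mM le_i le_j le_w.
  + have [in_i in_j in_k] : [/\ x.1.1.+1 < n, 0 < x.1.2 & x.2.+1 < n].
      by move: le_mM not_kept; rewrite minE /gap3; split; lia.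
    (* The third flag concerns [k], which rises when [cw] falls. *)
    apply: (@card_adj_steps _ _ true false true) => // y.
    rewrite /step adjE => xy; have [ly_i ly_j ly_w] := coord_lt y.
    by rewrite /clater later_low //; have := wE y; lia.
  + have [in_i in_j in_k] : [/\ 0 < x.1.1, x.1.2.+1 < n & x.2.+1 < n].
      by move: le_mM not_kept; rewrite minE /gap3; split; lia.
    apply: (@card_adj_steps _ _ false true true) => // y.
    rewrite /step adjE => xy; have [ly_i ly_j ly_w] := coord_lt y.
    rewrite /clater -laterCA later_low //.
    2: by rewrite gap3CA.
    2: by rewrite keptCA.
    2: by rewrite adj3CA.
    by have := wE y; lia.
  + have [in_i in_j in_k] : [/\ 0 < x.1.1, 0 < x.1.2 & 0 < x.2].
      by move: le_mM not_kept; rewrite minE /gap3; split; lia.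
    apply: (@card_adj_steps _ _ false false false) => // y.
    rewrite /step adjE => xy; have [ly_i ly_j ly_w] := coord_lt y.
    rewrite /clater -laterAC -laterCA later_low //.
    2: by rewrite gap3CA gap3AC.
    2: by rewrite keptCA keptAC.
    2: by rewrite adj3CA adj3AC.
    by have := wE y; lia.
pose s := maxn x.1.1 (maxn x.1.2 (cw x)).
have maxE : s = x.1.1 \/ s = x.1.2 \/ s = cw x by rewrite /s; lia.
have [le_i le_j le_w] : [/\ x.1.1 <= s, x.1.2 <= s & cw x <= s].
  by rewrite /s; split; lia.
rewrite /gap3 -/s in not_kept.
case: maxE => [maxE|[maxE|maxE]]; rewrite maxE in not_kept le_i le_j le_w.
- have [in_i in_j in_k] : [/\ 0 < x.1.1, x.1.2.+1 < n & 0 < x.2].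
    by move: lt_Mm not_kept; rewrite /gap3 -/s maxE /min3; split; lia.
  apply: (@card_adj_steps _ _ false true false) => // y.
  rewrite /step adjE => xy; have [ly_i ly_j ly_w] := coord_lt y.
  by rewrite /clater later_high //; have := wE y; lia.
- have [in_i in_j in_k] : [/\ x.1.1.+1 < n, 0 < x.1.2 & 0 < x.2].
    by move: lt_Mm not_kept; rewrite /gap3 -/s maxE /min3; split; lia.
  apply: (@card_adj_steps _ _ true false false) => // y.
  rewrite /step adjE => xy; have [ly_i ly_j ly_w] := coord_lt y.
  rewrite /clater -laterCA later_high //.
  2: by rewrite gap3CA min3CA.
  2: by rewrite keptCA.
  2: by rewrite adj3CA.
  by have := wE y; lia.
have [in_i in_j in_k] : [/\ x.1.1.+1 < n, x.1.2.+1 < n & x.2.+1 < n].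
  by move: lt_Mm not_kept; rewrite /gap3 -/s maxE /min3; split; lia.
apply: (@card_adj_steps _ _ true true true) => // y.
rewrite /step adjE => xy; have [ly_i ly_j ly_w] := coord_lt y.
rewrite /clater -laterAC -laterCA later_high //.
2: by rewrite gap3CA gap3AC min3CA min3AC.
2: by rewrite keptCA keptAC.
2: by rewrite adj3CA adj3AC.
by have := wE y; lia.
Qed.

(** * Coordinate inequalities for the two heaps *)

(** As [level x] is [a + b + c + 2 - n], layer [l] means [a + b + c = n - 1 + l] with every
    coordinate at least [l], and [HO n] means [a + b + c <= n - 1]. *)
Lemma NHOE n (x : cube n) :
  (x \in NHO n) = (x.1.1 + x.1.2 + cw x < n + min3 x.1.1 x.1.2 (cw x)).
Proof.
case: x => [[i j] k]; have := (ltn_ord i, ltn_ord j, ltn_ord k).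
rewrite /NHO /HO !inE !in_bigcup_seq /min3 /cw /= => -[[lt_i lt_j] lt_k].
apply/orP/idP => [[]/hasP[m]|lt_s].
- by rewrite mem_index_iota inE /level /ci /cj /ck /=; lia.
- by rewrite mem_index_iota inE /level /ci /cj /ck /=; lia.
have [le_s|gt_s] := leqP (i + j + (n.-1 - k)) n.-1; [left | right]; apply/hasP.
  exists (i + j + (n - k)); rewrite ?mem_index_iota ?inE;
  by rewrite /level /ci /cj /ck /=; lia.
exists (i + j + (n - k) - n); rewrite ?mem_index_iota ?inE;
by rewrite /level /ci /cj /ck /=; lia.
Qed.

(** In these coordinates [rho] sends [(a, b, c)] to [(n-1-b, n-1-a, n-1-c)], so the minimum of the
    source is the gap of the image. *)
Lemma rhoNHOE n (x : cube n) : 1 < n ->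
  (x \in @rho n @: NHO n.-1) =
    (2 * n <= x.1.1 + x.1.2 + cw x + gap3 n x.1.1 x.1.2 (cw x) + 1).
Proof.
case: n x => [|[|n]] // [[i j] k] _; rewrite /gap3.
have := (ltn_ord i, ltn_ord j, ltn_ord k) => -[[lt_i lt_j] lt_k].
apply/imsetP/idP => [[[[i' j'] k'] + ->]|].
  rewrite NHOE /min3 /cw /=.
  have := (ltn_ord i', ltn_ord j', ltn_ord k') => /= -[[? ?] ?].
  by lia.
rewrite /cw /= => le_s.
(* These bounds put the cube in the range of [rho] and keep [inord] off its default value. *)
have [i_gt0 j_gt0 k_le] : [/\ 0 < i, 0 < j & k <= n] by split; lia.
exists (inord (n.+1 - j), inord (n.+1 - i), inord (n - k)).
  by rewrite NHOE /min3 /cw /= !inordK; lia.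
by apply/eqP; rewrite /rho !xpair_eqE -!val_eqE /= !inordK; lia.
Qed.

Theorem theorem4 (n : nat) (hn : 2 <= n) :
  [/\ can_be_dismantled_to (NHO n :|: @rho n @: NHO n.-1),
      [disjoint NHO n & @rho n @: NHO n.-1]
    & @rho n @: UTB n.-1 n.-1 = LTB n n.-1].
Proof.
split.
- apply: (connect_move_rank (r := @crank n)) => [x y xy _|x].
    exact: adj_crank_neq.
  rewrite in_setU NHOE rhoNHOE // -/(kept _ _ _ _) => /card_clater <-.
  congr #|pred_of_set _|; apply/setP=> y.
  rewrite [LHS]inE [RHS]inE in_setU NHOE rhoNHOE //.
  by rewrite /crank rank_lt ?sum_le.
(* The two largest coordinates would sum to less than [n] and the two smallest to at least [n]. *)
- apply/pred0P=> x /=; rewrite NHOE rhoNHOE //.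
  by case: (coord_lt x); rewrite /min3 /gap3; lia.
(* [rho] sends level [l] to [n + 2 - l], hence level 1 of [UTB] to level [n + 1] of [LTB]. *)
apply/setP=> x; rewrite inE; case: n hn x => [|[|n]] // _ x.
apply/imsetP/idP => [[[[i j] k] + ->]|].
  rewrite inE /level /ci /cj /ck /=.
  by have := (ltn_ord i, ltn_ord j, ltn_ord k) => /= -[[? ?] ?]; lia.
case: x => [[i j] k]; rewrite /level /ci /cj /ck /= => level_x.
have := (ltn_ord i, ltn_ord j, ltn_ord k) => /= -[[lt_i lt_j] lt_k].
exists (inord (n.+1 - j), inord (n.+1 - i), inord (n - k)).
  by rewrite inE /level /ci /cj /ck /= !inordK; lia.
by apply/eqP; rewrite /rho !xpair_eqE -!val_eqE /= !inordK; lia.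
Qed.
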